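(* Let $\mathfrak{L}$ be a linearly ordered idempotent semifield with $\mathfrak{L}\neq\mathbb{B}$ and let $n\geq 1$. Each maximal subgroup of the semigroup $UT_n(\mathfrak{L}^* )$ is isomorphic to the group $(\mathfrak{L}^*,\cdot)$.
   Context: A linearly ordered idempotent semifield is a commutative semiring $\mathfrak{L}$ with $x+x=x$ for all $x$, in which $\mathfrak{L}^*=\mathfrak{L}\setminus\{\mathbf{0}\}$ is an abelian group under multiplication, and in which the order $a\leq b\iff a+b=b$ is total (so addition is maximum). $\mathbb{B}$ is the two-element Boolean semifield. $UT_n(\mathfrak{L}^* )$ is the semigroup (under matrix multiplication) of upper triangular $n\times n$ matrices over $\mathfrak{L}$ all of whose entries on and above the diagonal are non-zero. *)

(* Defs.v *)
From HB Require Import structures.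
From mathcomp Require Import all_boot all_order all_algebra.
From mathcomp Require Import classical_sets functions.

Set Implicit Arguments.
Unset Strict Implicit.
Unset Printing Implicit Defensive.

Import GRing.Theory.
Local Open Scope ring_scope.

(* The order of an idempotent semiring is a <= b iff a + b = b.  Closure of the
   set of nonzero elements under multiplication is not assumed: it follows from
   the existence of inverses (idemsf_mulf_neq0 below). *)
HB.mixin Record isLinOrdIdemSemifield L of GRing.ComNzSemiRing L := {
  idemsf_addxx : forall x : L, x + x = x;
  idemsf_mulVx : forall x : L, x != 0 -> exists y : L, y * x == 1;
  idemsf_total : total (fun a b : L => a + b == b)
}.

#[short(type="linOrdIdemSemifieldType")]
HB.structure Definition LinOrdIdemSemifield :=
  { L of isLinOrdIdemSemifield L & GRing.ComNzSemiRing L }.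

(* An alias of bool is needed because the library instance on bool is the field
   F_2, whose addition is exclusive or. *)
Definition boolean : Type := bool.

HB.instance Definition _ := Choice.on boolean.
HB.instance Definition _ := GRing.isNmodule.Build boolean orbA orbC orFb.
HB.instance Definition _ := GRing.Nmodule_isComNzSemiRing.Build boolean
  andbA andbC andTb andb_orl andFb isT.

Lemma boolean_addxx (x : boolean) : x + x = x.
Proof. exact: orbb. Qed.

Lemma boolean_mulVx (x : boolean) : x != 0 -> exists y : boolean, y * x == 1.
Proof. by case: x => // _; exists true. Qed.

Lemma boolean_total : total (fun a b : boolean => a + b == b).
Proof. by case; case. Qed.

HB.instance Definition _ :=
  isLinOrdIdemSemifield.Build boolean boolean_addxx boolean_mulVx boolean_total.

Section Semifield.
Variable L : linOrdIdemSemifieldType.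

Lemma idemsf_addr_neq0 (x y : L) : x != 0 -> x + y != 0.
Proof.
apply: contra_neq => xy0.
by rewrite -[x]addr0 -xy0 addrA idemsf_addxx.
Qed.

Lemma idemsf_sum_neq0 (I : finType) (i : I) (F : I -> L) :
  F i != 0 -> \sum_j F j != 0.
Proof. by rewrite (bigD1 i) //=; apply: idemsf_addr_neq0. Qed.

Lemma idemsf_mulf_neq0 (x y : L) : x != 0 -> y != 0 -> x * y != 0.
Proof.
move=> /idemsf_mulVx[z /eqP zx1]; apply: contra_neq => xy0.
by rewrite -[y]mul1r -zx1 -mulrA xy0 mulr0.
Qed.

Record nonzero : Type := Nonzero { nzval :> L; _ : nzval != 0 }.

HB.instance Definition _ := [isSub for nzval].
HB.instance Definition _ := [Choice of nonzero by <:].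

Lemma nonzeroP (x : nonzero) : nzval x != 0.
Proof. exact: valP x. Qed.

Definition nz_mul (x y : nonzero) : nonzero :=
  Nonzero (idemsf_mulf_neq0 (nonzeroP x) (nonzeroP y)).

Definition nz_one : nonzero := Nonzero (oner_neq0 L).

Lemma nz_inv_subproof (x : nonzero) :
  xchoose (idemsf_mulVx _ (nonzeroP x)) != 0.
Proof.
apply/eqP => y0; have := xchooseP (idemsf_mulVx _ (nonzeroP x)).
by rewrite y0 mul0r eq_sym (negPf (oner_neq0 L)).
Qed.

Definition nz_inv (x : nonzero) : nonzero := Nonzero (nz_inv_subproof x).

Lemma nz_mulA : associative nz_mul.
Proof. by move=> x y z; apply: val_inj; rewrite /= mulrA. Qed.

Lemma nz_mul1x : left_id nz_one nz_mul.
Proof. by move=> x; apply: val_inj; rewrite /= mul1r. Qed.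

Lemma nz_mulx1 : right_id nz_one nz_mul.
Proof. by move=> x; apply: val_inj; rewrite /= mulr1. Qed.

Lemma nz_mulVx : left_inverse nz_one nz_inv nz_mul.
Proof. by move=> x; apply: val_inj; exact/eqP/(xchooseP (idemsf_mulVx _ _)). Qed.

Lemma nz_mulxV : right_inverse nz_one nz_inv nz_mul.
Proof.
by move=> x; rewrite -(nz_mulVx x); apply: val_inj; rewrite /= mulrC.
Qed.

HB.instance Definition _ :=
  isGroup.Build nonzero nz_mulA nz_mul1x nz_mulx1 nz_mulVx nz_mulxV.

Variable n : nat.

Definition is_ut (A : 'M[L]_n) : bool :=
  [forall i : 'I_n, forall j : 'I_n,
     if (i <= j)%N then A i j != 0 else A i j == 0].

Lemma is_utP (A : 'M[L]_n) :
  reflect (forall i j : 'I_n, if (i <= j)%N then A i j != 0 else A i j == 0)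
          (is_ut A).
Proof. by apply: (iffP forallP) => A_ut i; apply/forallP/A_ut. Qed.

Lemma is_ut_mulmx (A B : 'M[L]_n) : is_ut A -> is_ut B -> is_ut (A *m B).
Proof.
move=> /is_utP A_ut /is_utP B_ut; apply/is_utP => i j; rewrite mxE.
case: leqP => [le_ij | lt_ji].
  apply: (@idemsf_sum_neq0 _ i); apply: idemsf_mulf_neq0.
    by have := A_ut i i; rewrite leqnn.
  by have := B_ut i j; rewrite le_ij.
apply/eqP/big1 => k _; case: (leqP i k) => [le_ik | lt_ki].
  have := B_ut k j; rewrite leqNgt (leq_trans lt_ji le_ik) /= => /eqP->.
  by rewrite mulr0.
by have := A_ut i k; rewrite leqNgt lt_ki /= => /eqP->; rewrite mul0r.
Qed.

Record UT : Type := MkUT { utval :> 'M[L]_n; _ : is_ut utval }.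

HB.instance Definition _ := [isSub for utval].
HB.instance Definition _ := [Choice of UT by <:].

Definition ut_mul (A B : UT) : UT := MkUT (is_ut_mulmx (valP A) (valP B)).

Lemma ut_mulA : associative ut_mul.
Proof. by move=> A B C; apply: val_inj; rewrite /= mulmxA. Qed.

HB.instance Definition _ := isSemigroup.Build UT ut_mulA.

End Semifield.

Arguments UT : clear implicits.

Section MaximalSubgroups.
Variable S : semigroupType.
Local Open Scope group_scope.
Local Open Scope classical_set_scope.

(* The identity of a subgroup of a semigroup may be any idempotent. *)
Definition is_subgroup (H : set S) : Prop :=
  [/\ forall x y, H x -> H y -> H (x * y)
    & exists e, [/\ H e,
        forall x, H x -> e * x = x /\ x * e = x
      & forall x, H x -> exists y, [/\ H y, x * y = e & y * x = e]]].

Definition is_maximal_subgroup (H : set S) : Prop :=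
  is_subgroup H /\ forall K : set S, is_subgroup K -> H `<=` K -> K = H.

Definition group_isomorphic_to (G : groupType) (H : set S) : Prop :=
  exists f : {multiplicative G -> S}, set_bij [set: G] H f.

End MaximalSubgroups.

(* Main.v *)
Require Import Defs.
From HB Require Import structures.
From mathcomp Require Import all_boot all_order all_algebra.
From mathcomp Require Import classical_sets functions.

(** A maximal subgroup [H] has as its identity an idempotent [E] of the semigroup,
    and the diagonal of [E] consists of ones because each diagonal entry is an
    idempotent of the group of nonzero elements.  The nonzero multiples [a E]
    form a subgroup which is a copy of that group, so it is enough to show
    that [H] is exactly this set of multiples.

    The point is that every [X] in [H] is a multiple of [E].  Let [Y] be its
    inverse.  A sum dominates each of its terms, so for [i <= j] the equations
    [X Y = E] and [E Y = Y] give [X_ii E_ij Y_jj <= X_ii Y_ij <= E_ij].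
    Cancelling [E_ij], which is where it matters that the entries above the
    diagonal are nonzero, and multiplying by [X_jj] gives [X_ii <= X_jj].  The
    same inequality for [Y], whose diagonal is inverse to that of [X], reads
    [X_jj <= X_ii]; hence the diagonal of [X] is constant
    ([ut_unit_diag_const]).  With a constant diagonal the displayed chain of
    inequalities closes up and forces [E_ij = X_ii Y_ij], so [Y], and by
    symmetry [X], is a multiple of [E] ([ut_unit_scale]).  Maximality then
    turns the inclusion of [H] in the group of multiples into an equality. *)

Set Implicit Arguments.
Unset Strict Implicit.
Unset Printing Implicit Defensive.

Import GRing.Theory.
Local Open Scope ring_scope.

Section IdempotentOrder.
Variable L : linOrdIdemSemifieldType.
Implicit Types a b c : L.

Definition idem_le a b := a + b = b.

Lemma idem_le_trans b a c : idem_le a b -> idem_le b c -> idem_le a c.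
Proof. by rewrite /idem_le => ab bc; rewrite -bc addrA ab. Qed.

Lemma idem_le_anti a b : idem_le a b -> idem_le b a -> a = b.
Proof. by rewrite /idem_le => ab ba; rewrite -ba addrC. Qed.

Lemma idem_le_mull c a b : idem_le a b -> idem_le (c * a) (c * b).
Proof. by rewrite /idem_le -mulrDr => ->. Qed.

Lemma idem_le_sum (I : finType) (i : I) (F : I -> L) :
  idem_le (F i) (\sum_j F j).
Proof. by rewrite /idem_le (bigD1 i) //= addrA idemsf_addxx. Qed.

Lemma idemsf_mulfI c : c != 0 -> injective ( *%R c).
Proof.
move=> /idemsf_mulVx[d /eqP dc1] a b /= cacb.
by rewrite -[a]mul1r -[b]mul1r -dc1 -!mulrA cacb.
Qed.

Lemma idem_le_mull_inv c a b : c != 0 -> idem_le (c * a) (c * b) -> idem_le a b.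
Proof. by rewrite /idem_le -mulrDr => /idemsf_mulfI cI /cI. Qed.

End IdempotentOrder.

Section UpperTriangular.
Variables (L : linOrdIdemSemifieldType) (n : nat).
Implicit Types (A B E X Y : UT L n) (a b : nonzero L) (i j k : 'I_n).

Lemma ut_neq0 A i j : (i <= j)%N -> A i j != 0.
Proof. by move=> le_ij; have /is_utP/(_ i j) := valP A; rewrite le_ij. Qed.

Lemma ut_eq0 A i j : (j < i)%N -> A i j = 0.
Proof.
by move=> lt_ji; have /is_utP/(_ i j) := valP A; rewrite leqNgt lt_ji => /eqP.
Qed.

Lemma ut_mul_diag A B i : (A * B)%g i i = A i i * B i i.
Proof.
rewrite mxE (bigD1 i) //= big1 ?addr0 // => k; rewrite neq_ltn => /orP[ki|ik].
  by rewrite ut_eq0 ?mul0r.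
by rewrite [B k i]ut_eq0 ?mulr0.
Qed.

Lemma ut_mul_ge A B i j k : idem_le (A i k * B k j) ((A * B)%g i j).
Proof. by rewrite mxE; apply: (idem_le_sum _ (fun k => A i k * B k j)). Qed.

Lemma ut_idem_diag E i : (E * E)%g = E -> E i i = 1.
Proof.
move=> EE; apply: (@idemsf_mulfI _ (E i i)); first exact: ut_neq0.
by rewrite /= mulr1 -ut_mul_diag EE.
Qed.

Section UnitsBelowIdempotent.
Variable E : UT L n.
Hypothesis EE : (E * E)%g = E.

Lemma ut_unit_diagV X Y i : (X * Y)%g = E -> X i i * Y i i = 1.
Proof. by move=> XY; rewrite -ut_mul_diag XY ut_idem_diag. Qed.

(** The entry [E_ij] is nonzero, so it cancels from
    [X_ii E_ij Y_jj <= X_ii Y_ij <= E_ij], leaving [X_ii Y_jj <= 1]. *)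
Lemma ut_unit_diag_mono X Y i j :
  (X * Y)%g = E -> (E * Y)%g = Y -> (i <= j)%N -> idem_le (X i i) (X j j).
Proof.
move=> XY EY le_ij.
have leE : idem_le (X i i * (E i j * Y j j)) (E i j).
  apply: (@idem_le_trans _ (X i i * Y i j)).
    by apply: idem_le_mull; rewrite -{2}EY; apply: ut_mul_ge.
  by rewrite -[in X in idem_le _ X]XY; apply: ut_mul_ge.
have le1 : idem_le (X i i * Y j j) 1.
  apply: (@idem_le_mull_inv _ (E i j)); first exact: ut_neq0.
  by rewrite mulr1 mulrCA.
have := idem_le_mull (X j j) le1.
by rewrite mulr1 mulrCA (ut_unit_diagV _ XY) mulr1.
Qed.

(** Inversion reverses the order, so the monotonicity of the diagonal of [Y]
    is the reverse monotonicity of the diagonal of [X]. *)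
Lemma ut_unit_diag_const X Y i j :
    (X * Y)%g = E -> (Y * X)%g = E -> (E * X)%g = X -> (E * Y)%g = Y ->
  X i i = X j j.
Proof.
move=> XY YX EX EY; wlog le_ij : i j / (i <= j)%N.
  by move=> W; case/orP: (leq_total i j) => /W // ->.
apply: idem_le_anti (ut_unit_diag_mono XY EY le_ij) _.
have := idem_le_mull (X i i * X j j) (ut_unit_diag_mono YX EX le_ij).
by rewrite mulrAC -[_ * _ * Y j j]mulrA !(ut_unit_diagV _ XY) mul1r mulr1.
Qed.

(** With [Y_ii = Y_jj], the terms of the sums [E X = X] and [Y X = E] give
    [E_ij = Y_ii E_ij X_jj <= Y_ii X_ij <= E_ij].  The index [k] is free because
    the diagonal of [X] is constant. *)
Lemma ut_unit_scale X Y i j k :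
    (X * Y)%g = E -> (Y * X)%g = E -> (E * X)%g = X -> (E * Y)%g = Y ->
  X i j = X k k * E i j.
Proof.
move=> XY YX EX EY; have [le_ij | lt_ji] := leqP i j; last first.
  by rewrite !(ut_eq0 _ lt_ji) mulr0.
rewrite (ut_unit_diag_const k i XY YX EX EY).
suff -> : E i j = Y i i * X i j by rewrite mulrA (ut_unit_diagV _ XY) mul1r.
apply: idem_le_anti; last by rewrite -[in X in idem_le _ X]YX; apply: ut_mul_ge.
have leX : idem_le (E i j * X j j) (X i j).
  by rewrite -[in X in idem_le _ X]EX; apply: ut_mul_ge.
have := idem_le_mull (Y i i) leX.
rewrite (ut_unit_diag_const i j YX XY EY EX) mulrCA.
by rewrite (ut_unit_diagV _ YX) mulr1.
Qed.

End UnitsBelowIdempotent.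

Lemma is_ut_scale a A : is_ut (nzval a *: utval A).
Proof.
apply/is_utP => i j; rewrite mxE; case: leqP => [le_ij | lt_ji].
  by rewrite idemsf_mulf_neq0 ?nonzeroP ?ut_neq0.
by rewrite ut_eq0 ?mulr0.
Qed.

Definition ut_scale A a : UT L n := MkUT (is_ut_scale a A).

Section Multiples.
Variable E : UT L n.
Hypothesis EE : (E * E)%g = E.

Lemma ut_scaleM : {morph ut_scale E : a b / (a * b)%g}.
Proof.
move=> a b; apply: val_inj; apply/matrixP => i j.
rewrite !mxE -[in LHS]EE mxE mulr_sumr; apply: eq_bigr => k _.
by rewrite !mxE mulrACA.
Qed.

Lemma ut_scale_inj : (0 < n)%N -> injective (ut_scale E).
Proof.
move=> n_gt0 a b /(congr1 (fun A : UT L n => A (Ordinal n_gt0) (Ordinal n_gt0))).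
by rewrite !mxE ut_idem_diag // !mulr1 => /val_inj.
Qed.

Lemma is_subgroup_ut_scale : is_subgroup (range (ut_scale E)).
Proof.
split=> [_ _ [a _ <-] [b _ <-] | ]; first by exists (a * b)%g; rewrite ?ut_scaleM.
exists (ut_scale E 1%g); split=> [|_ [a _ <-]|_ [a _ <-]]; first by exists 1%g.
  by rewrite -!ut_scaleM mul1g mulg1.
exists (ut_scale E a^-1%g); rewrite -!ut_scaleM mulgV mulVg.
by split=> //; exists a^-1%g.
Qed.

End Multiples.

End UpperTriangular.

Theorem theorem6p6 (L : linOrdIdemSemifieldType)
    (hL : ~ (exists f : {rmorphism L -> boolean}, bijective f))
    (n : nat) (hn : (1 <= n)%N)
    (H : set (UT L n)) (hH : is_maximal_subgroup H) :
  group_isomorphic_to (nonzero L) H.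
Proof.
case: hH => -[_ [E [HE E1 EV]]] Hmax.
have EE : (E * E)%g = E by case: (E1 _ HE).
have sHE : (H `<=` range (ut_scale E))%classic.
  move=> X HX; have [Y [HY XY YX]] := EV _ HX.
  have [[EX _] [EY _]] := (E1 _ HX, E1 _ HY).
  exists (Nonzero (ut_neq0 X (leqnn (Ordinal hn)))) => //.
  apply: val_inj; apply/matrixP => i j.
  by rewrite mxE /= -(ut_unit_scale EE i j _ XY YX EX EY).
have <- := Hmax _ (is_subgroup_ut_scale EE) sHE.
pose scaleM := isMultiplicative.Build _ _ (ut_scale E) (ut_scaleM EE).
pose f : {multiplicative nonzero L -> UT L n} := HB.pack (ut_scale E) scaleM.
exists f; split=> [a _ | a b _ _ | _ [a _ <-]]; [| |by exists a].
- by exists a.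
- exact: ut_scale_inj.
Qed.
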